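(* Let $\alpha>0$ be irrational, let $z_{-1}\in\mathbb{C}$, and suppose that the greedy sequence $(z_n)_{n\ge 0}$ with parameters $(\alpha,z_{-1})$ is defined for all $n\ge 0$, with sign sequence $(\varepsilon_n)_{n\ge 0}$. If the sequence of signs is eventually periodic with period $p\in\mathbb{N}$, $p\ge 1$ (i.e. there is $N$ with $\varepsilon_{n+p}=\varepsilon_n$ for all $n\ge N$), then eventually all elements of the sequence are contained in a union of at most $p$ concentric circles; that is, there exist $M\ge 0$ and a set that is a union of at most $p$ circles in $\mathbb{C}$ with a common center such that $z_n$ belongs to this set for all $n\ge M$.
   Context: Greedy sequence with parameters $(\alpha,z_{-1})$, where $\alpha>0$ is irrational and $z_{-1}\in\mathbb{C}$: for $n\ge 0$, $z_n=z_{n-1}+\varepsilon_n e^{2\pi i\alpha n}$ where the sign $\varepsilon_n\in\{-1,1\}$ is chosen so as to minimize $|z_n|$. If $|z_{n-1}+e^{2\pi i\alpha n}|=|z_{n-1}-e^{2\pi i\alpha n}|$ for some $n$, the sequence terminates at $z_{n-1}$ (neither $z_n$ nor $\varepsilon_n$, nor any later term, is defined). *)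

(* Defs.v *)
From HB Require Import structures.
From mathcomp Require Import all_boot all_order all_algebra.
From mathcomp Require Import complex.
From mathcomp Require Import classical_sets reals trigo.

Set Implicit Arguments.
Unset Strict Implicit.
Unset Printing Implicit Defensive.

Import Order.TTheory GRing.Theory Num.Theory.
Local Open Scope ring_scope.
Local Open Scope classical_set_scope.

(* The complex number e^(2 pi i t). *)
Definition unit_exp (R : realType) (t : R) : R[i] :=
  (cos (2 * pi * t) +i* sin (2 * pi * t))%C.

(* [prev_term zm1 z n] is z_(n-1), the term z_(-1) being the parameter [zm1]. *)
Definition prev_term (R : realType) (zm1 : R[i]) (z : nat -> R[i]) (n : nat) : R[i] :=
  if n is m.+1 then z m else zm1.

(* [z] and [eps] are the terms and signs of the greedy sequence with parameters
   (alpha, zm1), defined for every n >= 0. The first clause is the absence of a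
   tie at step n: a tie would terminate the sequence. Norms are elements of
   R[i] but are real, so they are comparable for the partial order of R[i]. *)
Definition greedy_sequence (R : realType) (alpha : R) (zm1 : R[i])
    (z : nat -> R[i]) (eps : nat -> int) : Prop :=
  forall n : nat,
    let w := prev_term zm1 z n in
    let u := unit_exp (alpha * n%:R) in
    [/\ `|w + u| <> `|w - u|,
        eps n \in [:: -1; 1],
        z n = w + (eps n)%:~R * u
      & forall s : int, s \in [:: -1; 1] -> `|z n| <= `|w + s%:~R * u|].

Definition circle (R : realType) (c : R[i]) (r : R) : set R[i] :=
  [set w | `|w - c| = r%:C%C].

(* Main.v *)
Require Import Defs.
From mathcomp Require Import all_boot all_order all_algebra.
From mathcomp Require Import complex ring lra.
From mathcomp Require Import boolp classical_sets reals trigo.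

Import Order.TTheory GRing.Theory Num.Theory.
Local Open Scope ring_scope.
Local Open Scope classical_set_scope.

(** Write u_n = e^(2 pi i alpha n) and q = u_p, so that u_(n+p) = q u_n, where
    q has modulus 1 and q <> 1 because alpha is irrational. Once the signs have
    period p, the increments eps_n u_n of the sequence are multiplied by q when
    n grows by p. Hence z_(n+p) and q z_n have the same increments and differ
    by a constant, which says that n |-> n + p acts on the sequence as the
    rotation by q about a fixed point c ([partial_sums_rotate]). Each of the p
    residue classes modulo p therefore stays on one circle centred at c.

    It remains to see that none of these circles degenerates to the point c.
    If z_n = c for some large n, then z_(n+kp) = c for all k, and the sign
    chosen next is always the same sign e by periodicity. The greedy rule makes
    the inner product of c and e u_(n+1+kp) negative for every k ([greedy_sign]). But e u_(n+1+kp) = q^k e u_(n+1), and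
    the orbit of a point under a nontrivial rotation cannot remain in an open
    half plane bounded by a line through the origin
    ([rotation_leaves_half_plane]). *)

(** * Orbits of a rotation and half planes *)

Lemma lt0_of_uniform_decrease (R : archiRealFieldType) (e : R) (x : nat -> R) :
  0 < e -> (forall k, x k.+1 <= x k - e) -> exists k, x k < 0.
Proof.
move=> e_gt0 x_dec.
have x_le k : x k <= x 0%N - k%:R * e.
  elim: k => [|k IHk]; first by rewrite mul0r subr0.
  by have := x_dec k; rewrite -natr1; lra.
exists (Num.bound `|x 0%N / e|); apply: le_lt_trans (x_le _) _.
rewrite subr_lt0 -ltr_pdivrMr //.
exact: le_lt_trans (ler_norm _) (archi_boundP (normr_ge0 _)).
Qed.

(** The recurrence reads: the second difference of [a] is [- delta * a].
    While [a] is positive it is concave. A positive concave sequence on the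
    naturals cannot ever decrease, so it is bounded below by [a 0]; then its
    slope drops by at least [delta * a 0] at each step, and becomes negative
    after all. *)
Lemma oscillation_nonpos (R : archiRealFieldType) (delta : R) (a : nat -> R) :
    0 < delta ->
    (forall k, a k.+2 - a k.+1 = a k.+1 - a k - delta * a k.+1) ->
  exists k, a k <= 0.
Proof.
move=> delta_gt0 a_rec; apply: contrapT => /forallNP a_nle0.
have a_gt0 k : 0 < a k by rewrite ltNge; apply/negP/a_nle0.
pose d k := a k.+1 - a k.
have d_dec k : d k.+1 <= d k.
  by rewrite /d a_rec gerDl oppr_le0 mulr_ge0 // ltW.
have d_ge0 k : 0 <= d k.
  rewrite leNgt; apply/negP => dk_lt0.
  (* A negative slope never recovers, so [a] would decrease linearly. *)
  have dj_le j : d (k + j)%N <= d k.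
    by elim: j => [|j]; rewrite ?addn0 // addnS; apply: le_trans.
  have [||j] := @lt0_of_uniform_decrease R (- d k) (fun j => a (k + j)%N).
  - by rewrite oppr_gt0.
  - by move=> j; have := dj_le j; rewrite /d addnS; lra.
  - by have := a_gt0 (k + j)%N; lra.
have a0_le k : a 0%N <= a k.
  by elim: k => // k IHk; have := d_ge0 k; rewrite /d; lra.
have [||k] := @lt0_of_uniform_decrease R (delta * a 0%N) d.
- exact: mulr_gt0.
- by move=> k; rewrite /d a_rec lerB // ler_wpM2l // ltW.
- by rewrite ltNge d_ge0.
Qed.

Lemma normc_eq1_sqr (R : realType) (q : R[i]) :
  `|q| = 1 -> complex.Re q ^+ 2 + complex.Im q ^+ 2 = 1.
Proof. by move=> q1; apply: (@complexI _); rewrite add_Re2_Im2 q1 expr1n. Qed.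

(** Since q has modulus 1, q^2 + 1 = 2 Re(q) q, so the real parts of the orbit
    satisfy the recurrence of [oscillation_nonpos] with
    delta = 2 - 2 Re(q), which is positive precisely because q <> 1. This
    elementary argument replaces the density of the orbit on its circle, and
    covers roots of unity as well. *)
Lemma rotation_leaves_half_plane (R : realType) (q v : R[i]) :
  `|q| = 1 -> q != 1 -> exists k, complex.Re (q ^+ k * v) <= 0.
Proof.
move=> /normc_eq1_sqr q_sqr q_neq1.
have Req_lt1 : complex.Re q < 1.
  move: q_sqr q_neq1; case: q => c s /= q_sqr; rewrite eq_complex /= => cs.
  rewrite lt_neqAle; apply/andP; split; last by nra.
  apply: contra cs => /eqP c1; rewrite c1 eqxx /= -sqrf_eq0.
  by apply/eqP; move: q_sqr; rewrite c1; lra.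
apply: (@oscillation_nonpos _ (2 - 2 * complex.Re q)); first by lra.
move=> k; rewrite !exprS -!mulrA; move: (q ^+ k * v) q_sqr => {v q_neq1 Req_lt1}.
case: q => c s [x y] /= q_sqr.
have sE : s ^+ 2 = 1 - c ^+ 2 by rewrite -q_sqr addrC addKr.
by ring: sE.
Qed.

(** * The greedy choice of signs *)

(** By the identity |w + u|^2 - |w - u|^2 = 4 Re(w^* u). *)
Lemma Re_conjc_mul_lt0 (R : realType) (w u : R[i]) :
  `|w + u| < `|w - u| -> complex.Re ((w^*)%C * u) < 0.
Proof.
case: w u => [a b] [c d]; rewrite !normc_def ltcR /= => lt_sqrt.
have : (a + c) ^+ 2 + (b + d) ^+ 2 < (a - c) ^+ 2 + (b - d) ^+ 2.
  by rewrite ltNge; apply: contraTN lt_sqrt => /ler_wsqrtr; rewrite -leNgt.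
by nra.
Qed.

(** The greedy step always moves in a direction making an obtuse angle with
    the current position; the inequality is strict because ties are excluded. *)
Lemma greedy_sign (R : realType) (alpha : R) zm1 z eps n :
    greedy_sequence alpha zm1 z eps ->
  complex.Re ((eps n)%:~R *
    ((prev_term zm1 z n)^*%C * unit_exp (alpha * n%:R))) < 0.
Proof.
case/(_ n); set w := prev_term _ _ _; set u := unit_exp _.
move=> /eqP no_tie eps_pm z_def z_min.
rewrite mulrCA; apply: Re_conjc_mul_lt0; rewrite -z_def.
(* Comparing with the opposite sign gives a weak inequality, which the absence
   of a tie makes strict. *)
have := z_min (- eps n); rewrite mulrNz mulNr => z_le.
rewrite lt_neqAle z_le ?andbT; last first.
  by move: eps_pm; rewrite !inE => /orP[] /eqP->.
rewrite z_def; move: eps_pm; rewrite !inE => /orP[] /eqP->.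
  by rewrite mulrN1z mulN1r opprK eq_sym.
by rewrite mulr1z mul1r.
Qed.

(** * Points of the unit circle *)

Lemma unit_expD (R : realType) (s t : R) :
  unit_exp (s + t) = unit_exp s * unit_exp t.
Proof.
rewrite /unit_exp mulrDr cosD sinD; apply/eqP.
by rewrite eq_complex /= eqxx /= addrC.
Qed.

Lemma norm_unit_exp (R : realType) (t : R) : `|unit_exp t| = 1.
Proof. by rewrite normc_def /= cos2Dsin2 sqrtr1. Qed.

(** From cos (2 pi t) = 1 - 2 sin (pi t)^2 the hypothesis gives
    sin (pi t) = 0, and the sine has no zero strictly between two consecutive
    multiples of pi. *)
Lemma unit_exp_eq1 (R : realType) (t : R) :
  0 <= t -> unit_exp t = 1 -> exists n : nat, t = n%:R.
Proof.
move=> t_ge0 [cos1 _].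
have sin_pit : sin (pi * t) = 0.
  apply/eqP; rewrite -sqrf_eq0 sin2cos2.
  by move: cos1; rewrite -mulrA mulr_natl cos_mulr2n mulr2n => ?; apply/eqP; lra.
have /andP[n_le t_lt] := truncn_itv t_ge0; set n := Num.truncn t in n_le t_lt.
exists n; apply/eqP; rewrite eq_sym eq_le n_le leNgt /=; apply/negP => n_lt.
have : 0 < sin (pi * (t - n%:R)).
  apply: sin_gt0_pi; rewrite pmulr_rgt0 ?pi_gt0 // subr_gt0 n_lt /=.
  by rewrite gtr_pMr ?pi_gt0 // ltrBlDl natr1.
have := alternatingn (@sinDpi R) n (pi * (t - n%:R)).
rewrite mulrBr mulr_natr subrK sin_pit => /esym/eqP.
by rewrite mulf_eq0 signr_eq0 /= => /eqP->; rewrite ltxx.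
Qed.

Lemma unit_exp_irrational_neq1 (R : realType) (alpha : R) (p : nat) :
  0 < alpha -> irrational alpha -> (0 < p)%N -> unit_exp (alpha * p%:R) != 1.
Proof.
move=> alpha_gt0 alpha_irr p_gt0; apply/eqP => /unit_exp_eq1[|n alphap].
  by rewrite mulr_ge0 // ltW.
apply: alpha_irr; exists (n%:R / p%:R) => //.
by rewrite fmorph_div !rmorph_nat -alphap mulfK // pnatr_eq0 -lt0n.
Qed.

(** * Sequences with rotating increments *)

(** From N on, z_(n+p) - q z_n is constant since both terms have the same
    increments. Its constant value is (1 - q) c, where c is the fixed point of
    the affine map that sends z_n to z_(n+p). *)
Lemma partial_sums_rotate (F : fieldType) (q : F) (p N : nat) (z g : nat -> F) :
    q != 1 -> (forall n, z n.+1 = z n + g n.+1) ->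
    (forall n, (N <= n)%N -> g (n + p)%N = q * g n) ->
  exists c, forall n, (N <= n)%N -> z (n + p)%N - c = q * (z n - c).
Proof.
move=> q_neq1 z_rec g_rot.
exists ((z (N + p)%N - q * z N) / (1 - q)); set c := _ / _.
have q1 : 1 - q != 0 by rewrite subr_eq0 eq_sym.
have cE : z (N + p)%N - q * z N = (1 - q) * c by rewrite [RHS]mulrC divfK.
move=> n /subnK <-; elim: (n - N)%N => [|k IHk].
  by move/eqP: cE; rewrite add0n subr_eq => /eqP->; ring.
rewrite !addSn !z_rec -addSn g_rot; last by rewrite -addSn leq_addl.
by move/eqP: IHk; rewrite subr_eq => /eqP->; ring.
Qed.

Lemma rotate_iter (F : pzRingType) (q : F) (p N : nat) (d : nat -> F) :
    (forall n, (N <= n)%N -> d (n + p)%N = q * d n) ->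
  forall k n, (N <= n)%N -> d (n + k * p)%N = q ^+ k * d n.
Proof.
move=> d_rot k n Nn; elim: k => [|k IHk]; first by rewrite mul0n addn0 mul1r.
by rewrite mulSnr addnA d_rot ?IHk ?mulrA -?exprS // (leq_trans Nn) // leq_addr.
Qed.

Theorem theorem1 (R : realType) (alpha : R) (zm1 : R[i])
    (z : nat -> R[i]) (eps : nat -> int) (p : nat)
    (alpha_gt0 : 0 < alpha) (alpha_irr : irrational alpha)
    (z_greedy : greedy_sequence alpha zm1 z eps)
    (p_gt0 : (0 < p)%N)
    (eps_periodic :
       exists N : nat, forall n : nat, (N <= n)%N -> eps (n + p)%N = eps n) :
  exists (M : nat) (c : R[i]) (radii : seq R),
    [/\ (size radii <= p)%N,
        forall r : R, r \in radii -> 0 < r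
      & forall n : nat, (M <= n)%N ->
          (\bigcup_(r in [set` radii]) circle c r) (z n)].
Proof.
case: eps_periodic => N eps_per.
pose u n := unit_exp (alpha * n%:R); pose q := u p.
have uD m n : u (m + n)%N = u n * u m.
  by rewrite /u natrD mulrDr unit_expD mulrC.
have q_norm : `|q| = 1 by apply: norm_unit_exp.
have q_neq1 : q != 1 by apply: unit_exp_irrational_neq1.
have [|n Nn|c z_rot] :=
    @partial_sums_rotate _ q p N z (fun n => (eps n)%:~R * u n) q_neq1.
- by move=> n; case: (z_greedy n.+1).
- by rewrite eps_per // uD mulrCA.
have z_rotk k n : (N <= n)%N -> z (n + k * p)%N - c = q ^+ k * (z n - c).
  exact: (@rotate_iter _ q p N (fun n => z n - c) z_rot).
have epsk k n : (N <= n)%N -> eps (n + k * p)%N = eps n.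
  move=> Nn; elim: k => [|k IHk]; first by rewrite addn0.
  by rewrite mulSnr addnA eps_per // (leq_trans Nn) // leq_addr.
have uk k n : u (n + k * p)%N = q ^+ k * u n.
  by apply: (@rotate_iter _ q p 0) => // m _; rewrite uD.
have z_neqc n : (N <= n)%N -> z n != c.
  move=> Nn; apply/eqP => znc.
  have zc k : z (n + k * p)%N = c.
    by apply/eqP; rewrite -subr_eq0 z_rotk // znc subrr mulr0.
  have [k] := rotation_leaves_half_plane
    _ _ (- ((eps n.+1)%:~R * (c^*%C * u n.+1))) q_norm q_neq1.
  rewrite leNgt => /negP; apply.
  have := greedy_sign _ _ _ _ _ (n.+1 + k * p)%N z_greedy.
  rewrite -/(u _) uk epsk ?(leqW Nn) // addSn /= zc.
  rewrite mulrN raddfN /= oppr_gt0 !mulrA [q ^+ k * _]mulrC -!mulrA.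
  by rewrite [_^*%C * _]mulrCA.
pose rad n := complex.Re `|z n - c|.
exists N, c, [seq rad (N + i)%N | i <- iota 0 p]; split.
- by rewrite size_map size_iota.
- move=> r /mapP[i _ ->]; have : 0 < `|z (N + i)%N - c|.
    by rewrite normr_gt0 subr_eq0 z_neqc // leq_addr.
  by rewrite ltcE => /andP[].
move=> n Nn; exists (rad (N + (n - N) %% p)%N).
  by apply/mapP; exists ((n - N) %% p)%N; rewrite // mem_iota ltn_mod.
rewrite /circle /= RRe_real ?normr_real //.
rewrite -{1}(subnKC Nn) {1}(divn_eq (n - N) p) [X in (N + X)%N]addnC addnA.
by rewrite z_rotk ?leq_addr // normrM normrX q_norm expr1n mul1r.
Qed.
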